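(* Let $p$ be a positive prime integer with $p\equiv 13$ or $17 \pmod{20}$, let $l$ be a positive integer, and let $n=\frac{p(2l+1)+2l-1}{4}-1$ (which is an integer). Then the Fibonacci quaternion $F_n=f_n+f_{n+1}i+f_{n+2}j+f_{n+3}k$ is a zero divisor in the quaternion ring $\mathbb{H}_{\mathbb{Z}_p}(-1,-1)$.
   Context: $(f_n)_{n\ge 0}$ is the Fibonacci sequence: $f_0=0$, $f_1=1$, $f_n=f_{n-1}+f_{n-2}$ for $n\ge 2$. For a prime $p$, $\mathbb{Z}_p=\mathbb{Z}/p\mathbb{Z}$ and $\mathbb{H}_{\mathbb{Z}_p}(-1,-1)$ is the 4-dimensional associative unital $\mathbb{Z}_p$-algebra with basis $\{1,i,j,k\}$ and relations $i^2=j^2=-1$, $k=ij=-ji$. Integer coefficients are reduced modulo $p$. An element $x$ of a ring is a zero divisor if there is a nonzero $y$ with $xy=0$ or $yx=0$ (so $0$ counts as a zero divisor). *)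

(* Defs.v *)
From HB Require Import structures.
From mathcomp Require Import all_boot all_order all_algebra ring.

Set Implicit Arguments.
Unset Strict Implicit.
Unset Printing Implicit Defensive.

Import GRing.Theory.
Local Open Scope ring_scope.

Fixpoint fib (n : nat) : nat :=
  match n with
  | 0 => 0
  | 1 => 1
  | (n''.+1 as n').+1 => (fib n' + fib n'')%N
  end.

(* [Quat x y z t] stands for x + y i + z j + t k in H_R(a, b), that is,
   i^2 = a, j^2 = b and k = ij = - ji. The parameters a and b are phantom:
   they only select the multiplication. *)
Record quaternion (R : comNzRingType) (a b : R) : Type :=
  Quat { qre : R; qim_i : R; qim_j : R; qim_k : R }.

Section QuaternionAlgebra.
Variables (R : comNzRingType) (a b : R).
Local Notation H := (quaternion a b).
Implicit Types u v w : H.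

Definition quat_to_prod u : R * R * R * R :=
  (qre u, qim_i u, qim_j u, qim_k u).

Definition quat_of_prod (x : R * R * R * R) : H :=
  let: (x0, x1, x2, x3) := x in Quat a b x0 x1 x2 x3.

Lemma quat_to_prodK : cancel quat_to_prod quat_of_prod.
Proof. by case. Qed.

HB.instance Definition _ := Choice.copy H (can_type quat_to_prodK).

Definition quat_zero : H := Quat a b 0 0 0 0.

Definition quat_opp u : H :=
  Quat a b (- qre u) (- qim_i u) (- qim_j u) (- qim_k u).

Definition quat_add u v : H :=
  Quat a b (qre u + qre v) (qim_i u + qim_i v)
           (qim_j u + qim_j v) (qim_k u + qim_k v).

Lemma quat_addA : associative quat_add.
Proof. by move=> u v w; rewrite /quat_add /= !addrA. Qed.

Lemma quat_addC : commutative quat_add.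
Proof. by move=> u v; congr Quat; rewrite addrC. Qed.

Lemma quat_add0 : left_id quat_zero quat_add.
Proof. by case=> *; rewrite /quat_add /= !add0r. Qed.

Lemma quat_addN : left_inverse quat_zero quat_opp quat_add.
Proof. by case=> *; rewrite /quat_add /= !addNr. Qed.

HB.instance Definition _ :=
  GRing.isZmodule.Build H quat_addA quat_addC quat_add0 quat_addN.

Definition quat_one : H := Quat a b 1 0 0 0.

(* Bilinear extension of the table
     ii = a,   jj = b,   kk = - ab,
     ij = k,   ji = - k, ik = a j, ki = - a j, kj = b i, jk = - b i. *)
Definition quat_mul u v : H :=
  let: Quat x0 x1 x2 x3 := u in
  let: Quat y0 y1 y2 y3 := v in
  Quat a b
    (x0 * y0 + a * x1 * y1 + b * x2 * y2 - a * b * x3 * y3)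
    (x0 * y1 + x1 * y0 - b * x2 * y3 + b * x3 * y2)
    (x0 * y2 + x2 * y0 + a * x1 * y3 - a * x3 * y1)
    (x0 * y3 + x3 * y0 + x1 * y2 - x2 * y1).

Lemma quat_mulA : associative quat_mul.
Proof.
by move=> [x0 x1 x2 x3] [y0 y1 y2 y3] [z0 z1 z2 z3]; congr Quat; ring.
Qed.

Lemma quat_mul1 : left_id quat_one quat_mul.
Proof. by case=> x0 x1 x2 x3; congr Quat; ring. Qed.

Lemma quat_mulr1 : right_id quat_one quat_mul.
Proof. by case=> x0 x1 x2 x3; congr Quat; ring. Qed.

Lemma quat_mulDl : left_distributive quat_mul quat_add.
Proof.
by move=> [x0 x1 x2 x3] [y0 y1 y2 y3] [z0 z1 z2 z3]; congr Quat => /=; ring.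
Qed.

Lemma quat_mulDr : right_distributive quat_mul quat_add.
Proof.
by move=> [x0 x1 x2 x3] [y0 y1 y2 y3] [z0 z1 z2 z3]; congr Quat => /=; ring.
Qed.

Lemma quat_one_neq0 : quat_one != 0.
Proof. by apply/eqP => -[] /eqP; rewrite oner_eq0. Qed.

HB.instance Definition _ :=
  GRing.Zmodule_isNzRing.Build H quat_mulA quat_mul1 quat_mulr1
    quat_mulDl quat_mulDr quat_one_neq0.

Definition quat_scale (c : R) u : H :=
  Quat a b (c * qre u) (c * qim_i u) (c * qim_j u) (c * qim_k u).

Lemma quat_scaleA c d u :
  quat_scale c (quat_scale d u) = quat_scale (c * d) u.
Proof. by rewrite /quat_scale /= !mulrA. Qed.

Lemma quat_scale1 : left_id 1 quat_scale.
Proof. by case=> *; rewrite /quat_scale /= !mul1r. Qed.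

Lemma quat_scaleDr : right_distributive quat_scale +%R.
Proof. by move=> c u v; congr Quat; rewrite mulrDr. Qed.

Lemma quat_scaleDl u : {morph quat_scale^~ u : c d / c + d}.
Proof. by move=> c d; congr Quat; rewrite mulrDl. Qed.

HB.instance Definition _ :=
  GRing.Zmodule_isLmodule.Build R H quat_scaleA quat_scale1
    quat_scaleDr quat_scaleDl.

Lemma quat_scaleAl (c : R) u v : c *: (u * v) = (c *: u) * v.
Proof.
by case: u v => [x0 x1 x2 x3] [y0 y1 y2 y3]; congr Quat => /=; ring.
Qed.

HB.instance Definition _ := GRing.Lmodule_isLalgebra.Build R H quat_scaleAl.

Lemma quat_scaleAr (c : R) u v : c *: (u * v) = u * (c *: v).
Proof.
by case: u v => [x0 x1 x2 x3] [y0 y1 y2 y3]; congr Quat => /=; ring.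
Qed.

HB.instance Definition _ := GRing.Lalgebra_isAlgebra.Build R H quat_scaleAr.

Definition quat_i : H := Quat a b 0 1 0 0.
Definition quat_j : H := Quat a b 0 0 1 0.
Definition quat_k : H := Quat a b 0 0 0 1.

Lemma quat_basisE (x y z t : R) :
  x%:A + y *: quat_i + z *: quat_j + t *: quat_k = Quat a b x y z t.
Proof. by congr Quat => /=; ring. Qed.

Lemma quat_ii : quat_i ^+ 2 = a%:A.
Proof. by congr Quat => /=; ring. Qed.

Lemma quat_jj : quat_j ^+ 2 = b%:A.
Proof. by congr Quat => /=; ring. Qed.

Lemma quat_ij : quat_i * quat_j = quat_k.
Proof. by congr Quat => /=; ring. Qed.

Lemma quat_ji : quat_j * quat_i = - quat_k.
Proof. by congr Quat => /=; ring. Qed.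

Definition fib_quat (n : nat) : H :=
  (fib n)%:R%:A + (fib n.+1)%:R *: quat_i
  + (fib n.+2)%:R *: quat_j + (fib n.+3)%:R *: quat_k.

End QuaternionAlgebra.

(* A left or a right zero divisor; in particular 0 is one. *)
Definition zero_divisor (A : nzRingType) (x : A) : Prop :=
  exists2 y : A, y != 0 & x * y = 0 \/ y * x = 0.

(* Main.v *)
Require Import Defs.
From mathcomp Require Import all_boot all_order all_algebra.
From mathcomp Require Import all_field ring zify.

Import GRing.Theory.

Local Open Scope ring_scope.

(** The norm of F_n is the sum of the squares of f_n, ..., f_(n+3), which is
    3 f_(2n+3) by [fib_sum_sq]; a quaternion of norm 0 is a zero divisor, being
    killed by its conjugate ([zero_divisor_norm0]). For the given n we have
    2n + 3 = (2l + 1) (p + 1) / 2, so it suffices that p divides f_N whenever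
    N is an odd multiple of (p + 1) / 2 and N is odd ([fib_eq0_Fp]).

    For this, let alpha and beta be the roots of X^2 - X - 1 in an algebraic
    closure of F_p. They are Gaussian periods of order 5: alpha is
    - (zeta^2 + zeta^3) and beta is - (zeta + zeta^4) for a primitive fifth
    root of unity zeta. As p is 2 or 3 modulo 5, raising to the power p swaps
    the two sums, so alpha^p = beta and alpha^(p+1) = alpha beta = - 1
    ([golden_frobenius]). An odd power of this relation gives
    alpha^(2N) = - 1, that is, alpha^N = - alpha^(-N) = beta^N since N is odd,
    and f_N = 0 follows from the Binet formula ([fib_binet]), where
    alpha <> beta because (alpha - beta)^2 = 5. *)

(** * Zero divisors and the quaternion norm *)

Definition quat_conj {R : comNzRingType} {a b : R} (u : quaternion a b) :
  quaternion a b := Quat a b (qre u) (- qim_i u) (- qim_j u) (- qim_k u).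

Definition quat_norm {R : comNzRingType} {a b : R} (u : quaternion a b) : R :=
  qre u ^+ 2 - a * qim_i u ^+ 2 - b * qim_j u ^+ 2 + a * b * qim_k u ^+ 2.

Lemma quat_mul_conj {R : comNzRingType} {a b : R} (u : quaternion a b) :
  u * quat_conj u = (quat_norm u)%:A.
Proof. by case: u => x y z t; congr Quat; rewrite /quat_norm /=; ring. Qed.

Lemma quat_conjK {R : comNzRingType} {a b : R} :
  involutive (@quat_conj R a b).
Proof. by case=> x y z t; congr Quat; rewrite /= opprK. Qed.

Lemma quat_conj0 {R : comNzRingType} {a b : R} :
  quat_conj (0 : quaternion a b) = 0.
Proof. by congr Quat; rewrite /= oppr0. Qed.

(** The conjugate is a witness unless it vanishes, and then u itself is 0. *)
Lemma zero_divisor_norm0 {R : comNzRingType} {a b : R} (u : quaternion a b) :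
  quat_norm u = 0 -> zero_divisor u.
Proof.
move=> Nu0; have [-> | u_neq0] := eqVneq u 0.
  by exists 1; [exact: oner_neq0 | left; rewrite mul0r].
exists (quat_conj u); last by left; rewrite quat_mul_conj Nu0 scale0r.
by apply: contra_neq u_neq0 => u'0; rewrite -(quat_conjK u) u'0 quat_conj0.
Qed.

(** * Fibonacci identities *)

Lemma fibSS n : fib n.+2 = (fib n.+1 + fib n)%N.
Proof. by []. Qed.

(** Neither identity is inductive alone: each step uses both. *)
Lemma fib_double n :
  fib n.*2.+1 = (fib n ^ 2 + fib n.+1 ^ 2)%N /\
  fib n.*2.+2 = (fib n.+1 ^ 2 + 2 * fib n * fib n.+1)%N.
Proof.
elim: n => // n [IH1 IH2]; rewrite doubleS.
have E3 : fib n.*2.+3 = (fib n.+1 ^ 2 + fib n.+2 ^ 2)%N.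
  by rewrite fibSS IH1 IH2 fibSS; ring.
by split; rewrite // fibSS E3 IH2 fibSS; ring.
Qed.

Lemma fib_sum_sq n :
  (fib n ^ 2 + fib n.+1 ^ 2 + fib n.+2 ^ 2 + fib n.+3 ^ 2
   = 3 * fib n.*2.+3)%N.
Proof.
have [/esym E1 _] := fib_double n; have [/esym E5 _] := fib_double n.+2.
rewrite -addnA E1 E5 !doubleS (fibSS n.*2.+3) (fibSS n.*2.+2) (fibSS n.*2.+1).
ring.
Qed.

Lemma quat_norm_fib (R : comNzRingType) n :
  quat_norm (fib_quat (-1 : R) (-1) n) = (3 * fib n.*2.+3)%:R.
Proof.
rewrite -fib_sum_sq /fib_quat quat_basisE /quat_norm.
(* Generalizing keeps the recursive definition from being unfolded. *)
move: (fib n) (fib n.+1) (fib n.+2) (fib n.+3) => x y z t.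
by rewrite !natrD !natrX /=; ring.
Qed.

(** Dividing by alpha - beta would restrict the formula to fields with
    alpha <> beta; this form holds in every commutative ring. *)
Lemma fib_binet {R : comNzRingType} (alpha beta : R) n :
    alpha + beta = 1 -> alpha * beta = -1 ->
  (fib n)%:R * (alpha - beta) = alpha ^+ n - beta ^+ n.
Proof.
move=> sum1 prodN1.
have step (x y : R) m :
    x + y = 1 -> x * y = -1 -> x ^+ m.+2 = x ^+ m.+1 + x ^+ m.
  move=> xy1 xyN1; have x2 : x ^+ 2 = x + 1.
    by transitivity (x * (x + y) - x * y); [ring | rewrite xy1 xyN1; ring].
  by rewrite -addn2 exprD x2 exprS; ring.
have [] : (fib n)%:R * (alpha - beta) = alpha ^+ n - beta ^+ n /\
          (fib n.+1)%:R * (alpha - beta) = alpha ^+ n.+1 - beta ^+ n.+1.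
  elim: n => [|n [IH1 IH2]]; first by rewrite /= !expr0 !expr1; split; ring.
  split=> //; rewrite fibSS natrD mulrDl IH1 IH2.
  rewrite (step alpha beta) // (step beta alpha); [ring | |].
  - by rewrite addrC.
  - by rewrite mulrC.
by [].
Qed.

(** * Fibonacci numbers modulo p *)

(** The Frobenius map sends zeta^2 + zeta^3 to zeta^(2p) + zeta^(3p), and
    {2p, 3p} = {1, 4} modulo 5. *)
Lemma golden_frobenius {K : fieldType} (p : nat) (zeta : K) :
    p \in [pchar K] -> (p %% 5 = 2 \/ p %% 5 = 3)%N ->
    1 + zeta + zeta ^+ 2 + zeta ^+ 3 + zeta ^+ 4 = 0 ->
  let alpha := - (zeta ^+ 2 + zeta ^+ 3) in
  alpha * (1 - alpha) = -1 /\ alpha ^+ p = 1 - alpha.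
Proof.
move=> pK p5 zeta0 alpha.
have zeta5 : zeta ^+ 5 = 1.
  apply/eqP; rewrite -subr_eq0; apply/eqP.
  by rewrite -[RHS](mulr0 (zeta - 1)) -zeta0; ring.
have betaE : 1 - alpha = - (zeta + zeta ^+ 4).
  by apply/eqP; rewrite -subr_eq0 -zeta0; apply/eqP; rewrite /alpha; ring.
split.
  (* The product is zeta^3 + zeta^4 + zeta^6 + zeta^7, the sum of all the
     nontrivial fifth roots of unity. *)
  rewrite betaE -[RHS]addr0 -zeta0 /alpha.
  transitivity (zeta ^+ 3 + zeta ^+ 4 + zeta ^+ 5 * (zeta + zeta ^+ 2)).
    ring.
  by rewrite zeta5; ring.
rewrite betaE /alpha -(pFrobenius_autE pK) rmorphN rmorphD /=.
rewrite !pFrobenius_autE -!exprM -(expr_mod (2 * p) zeta5).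
rewrite -(expr_mod (3 * p) zeta5) -!(modnMmr _ p).
by case: p5 => ->; rewrite //= addrC.
Qed.

(** The hypothesis on N is N = k (p + 1) / 2, written without halving. *)
Lemma fib_eq0_Fp (p N k : nat) :
    prime p -> (p %% 5 = 2 \/ p %% 5 = 3)%N ->
    odd N -> odd k -> N.*2 = (p.+1 * k)%N ->
  (fib N)%:R = 0 :> 'F_p.
Proof.
move=> p_pr p5 oddN oddk NE.
have [K [iota _]] := countable_algebraic_closure 'F_p.
have pK : p \in [pchar K] by rewrite (fmorph_pchar iota) pchar_Fp.
have [zeta] : exists zeta : K, root (Poly [:: 1; 1; 1; 1; 1]) zeta.
  by apply/closed_rootP; rewrite (@PolyK _ 0) //= oner_neq0.
rewrite /root horner_Poly /= => /eqP zetaP.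
have zeta0 : 1 + zeta + zeta ^+ 2 + zeta ^+ 3 + zeta ^+ 4 = 0.
  by rewrite -zetaP; ring.
have [] := golden_frobenius p zeta pK p5 zeta0.
set alpha := - _ => prodN1 frob.
have alpha_neq0 : alpha != 0.
  by apply: contra_eq_neq prodN1 => ->; rewrite mul0r eq_sym oppr_eq0 oner_neq0.
have diff_neq0 : alpha - (1 - alpha) != 0.
  rewrite -sqrf_eq0.
  have -> : (alpha - (1 - alpha)) ^+ 2 = 5%:R.
    transitivity (1 - 4 * (alpha * (1 - alpha))); first by ring.
    by rewrite prodN1; ring.
  rewrite -(dvdn_pcharf pK) dvdn_prime2 //.
  by apply/eqP => pE; move: p5; rewrite pE => -[].
have binet := fib_binet alpha (1 - alpha) N (subrKC _ _) prodN1.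
apply/eqP; rewrite -(fmorph_eq0 iota) rmorph_nat.
rewrite -(mulIr_eq0 _ (mulIf diff_neq0)) binet.
(* Multiplying by alpha^N eliminates beta, since alpha^N beta^N = (- 1)^N. *)
rewrite -(mulrI_eq0 _ (mulfI (expf_neq0 N alpha_neq0))).
rewrite mulrBr -exprD -exprMn prodN1 addnn NE exprM exprS frob prodN1.
by rewrite -(signr_odd _ k) -(signr_odd _ N) oddN oddk subrr.
Qed.

Theorem theorem2p1 (p l : nat) (p_prime : prime p)
  (p_mod20 : p = 13 %[mod 20] \/ p = 17 %[mod 20]) (l_gt0 : (0 < l)%N) :
  exists2 n : nat,
    n%:Q = (p%:Q * (2 * l%:Q + 1) + 2 * l%:Q - 1) / 4 - 1 &
    zero_divisor (fib_quat (-1 : 'F_p) (-1 : 'F_p) n).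
Proof.
have [q pE] : exists q, p = (4 * q + 1)%N by exists (p %/ 4)%N; lia.
case: l l_gt0 => // l _.
(* With p = 4q + 1, this n satisfies 2n + 3 = (2q + 1) (2l + 3). *)
exists (2 * q * l.+1 + q + l)%N.
  rewrite pE -[l.+1]addn1 !PoszD !PoszM !rmorphD !rmorphM /=.
  by field.
apply: zero_divisor_norm0; rewrite quat_norm_fib natrM.
rewrite (fib_eq0_Fp p _ (2 * l + 3)) ?mulr0 //; lia.
Qed.
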